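(* Let $G$ be a finite connected undirected graph (multiple edges and loops allowed), with genus $g=|E(G)|-|V(G)|+1$. The number of partial orientations of $G$ modulo cycle reversals, i.e. the number of equivalence classes of partial orientations of $G$ under the equivalence relation generated by cycle reversals, is $2^{g}\,T_G(3,1)$, where $T_G(x,y)$ is the Tutte polynomial of $G$.
   Context: A partial orientation of $G$ is an orientation of a subset of the edges; the remaining edges are unoriented (each edge, including each loop, has two possible orientations or is unoriented). A directed cycle in a partial orientation is a cycle of $G$ all of whose edges are oriented, consistently along the cycle; an oriented loop is a directed cycle of length 1, and two parallel edges oriented oppositely form a directed cycle of length 2. A cycle reversal reverses the orientation of all edges in a directed cycle (for a loop, it switches between its two orientations). *)

(* Defs.v *)
From mathcomp Require Import all_boot all_order all_algebra.

Set Implicit Arguments.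
Unset Strict Implicit.
Unset Printing Implicit Defensive.

Import GRing.Theory.
Local Open Scope ring_scope.

(* A finite undirected multigraph, loops allowed.  The order of the two ends   *)
(* of an edge is an arbitrary reference direction, used only to name the two   *)
(* orientations of the edge (also when the edge is a loop).                    *)
Record multigraph := Multigraph {
  vertex : finType;
  edge : finType;
  src : edge -> vertex;
  tgt : edge -> vertex }.

Section Multigraph.

Variable G : multigraph.
Local Notation V := (vertex G).
Local Notation E := (edge G).

Definition adj (A : {set E}) : rel V :=
  [rel u v | [exists e in A, ((src e == u) && (tgt e == v))
                          || ((src e == v) && (tgt e == u))]].

Definition connected_graph : bool :=
  (0 < #|V|)%N && [forall u, forall v, connect (adj [set: E]) u v].

(* The subtraction is exact when G is connected, as then #|V| <= #|E| + 1.     *)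
Definition genus : nat := (#|E| + 1 - #|V|)%N.

Definition ncomponents (A : {set E}) : nat := n_comp (adj A) V.

Definition rank (A : {set E}) : nat := (#|V| - ncomponents A)%N.

(* Corank-nullity expansion, with x = 'X and y = 'Y; all the truncated         *)
(* subtractions are exact.                                                     *)
Definition tutte : {poly {poly int}} :=
  \sum_(A : {set E})
     ('X - 1) ^+ (rank [set: E] - rank A) * ('Y - 1) ^+ (#|A| - rank A).

(* Some true: oriented from src to tgt; Some false: from tgt to src; None:     *)
(* unoriented.                                                                 *)
Definition partial_orientation := {ffun E -> option bool}.

(* (e, b) is the edge e traversed from src to tgt if b, and from tgt to src    *)
(* otherwise.                                                                  *)
Definition dart := (E * bool)%type.
Definition dtail (d : dart) : V := if d.2 then src d.1 else tgt d.1.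
Definition dhead (d : dart) : V := if d.2 then tgt d.1 else src d.1.

(* The distinctness of the edges only matters for cycles of length 2.          *)
Definition graph_cycle (c : seq dart) : bool :=
  [&& c != [::], cycle [rel d d' | dhead d == dtail d'] c,
      uniq [seq dtail d | d <- c] & uniq [seq d.1 | d <- c]].

Definition directed_cycle (O : partial_orientation) (c : seq dart) : bool :=
  graph_cycle c && all [pred d | O d.1 == Some d.2] c.

Definition reverse_cycle (O : partial_orientation) (c : seq dart) :
    partial_orientation :=
  [ffun e => if e \in [seq d.1 | d <- c] then omap negb (O e) else O e].

(* The bound on the length of c is harmless: a cycle repeats no edge.          *)
Definition cycle_reversal : rel partial_orientation :=
  [rel O O' | [exists c : #|E|.-bseq dart,
                 directed_cycle O c && (O' == reverse_cycle O c)]].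

Definition cycle_reversal_equiv : rel partial_orientation :=
  connect [rel O O' | cycle_reversal O O' || cycle_reversal O' O].

Definition cycle_reversal_classes : {set {set partial_orientation}} :=
  equivalence_partition cycle_reversal_equiv [set: partial_orientation].

End Multigraph.

(* Main.v *)
Require Import Defs.
From mathcomp Require Import all_boot all_order all_algebra zify.

Set Implicit Arguments.
Unset Strict Implicit.
Unset Printing Implicit Defensive.

(** The reason the theorem holds is that the cycle reversal class of a partial
orientation is determined by two invariants: the set of its oriented edges
(its support) and its indegree vector.  Reversing a directed cycle changes
neither.  Conversely, if two partial orientations O and O' have the same
support and the same indegrees, the edges on which they differ, oriented as in
O, form a balanced digraph; each of its edges lies on a directed cycle, and
reversing one such cycle brings O closer to O' ([cycle_reversal_equivE]).

It remains to count, for each set A of edges, the indegree vectors of the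
orientations of A; there are as many as there are forests contained in A
([card_scores]).  Both numbers satisfy the same deletion-contraction
recurrence.  For forests this is classical: a forest of A + e either avoids e,
or is e plus a forest of the contraction G/e.  For indegree vectors, let S be
the set of vectors of A, and let e join u to v, with u different from v.  The
vectors of A + e form the union of S + [v] and S + [u], where [x] is the unit
vector at x.  The vectors of G/e are obtained from those of S by adding up the
coordinates at u and v, so they correspond to the fibres of this map on S.  Each
fibre is an interval in the direction [u] - [v] ([indeg_exchange]), hence the
part of the union that lies above a fibre has exactly one more element than the
fibre does.  So e adds to S as many vectors as G/e has.

Consequently the number of classes is the number of pairs of a forest F and a
set A containing F, that is, the sum over the forests F of 2 ^ (#|E| - #|F|).
At (3, 1) the corank-nullity expansion of the Tutte polynomial retains only the
forests, F contributing 2 ^ (#|V| - 1 - #|F|) when G is connected, and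
#|E| - #|F| is the sum of the genus and #|V| - 1 - #|F|. *)

(** * Cardinals of images *)

(** Several counts below replace a map by another one with the same fibres:
both images are in bijection with the set of fibres, realized here as the image
of the pairing of the two maps. *)
Lemma eq_card_imset_kernel (T S1 S2 : finType) (f1 : T -> S1) (f2 : T -> S2)
    (D : {set T}) :
  {in D &, forall x y, (f1 x == f1 y) = (f2 x == f2 y)} ->
  #|f1 @: D| = #|f2 @: D|.
Proof.
move=> eqf; pose g x := (f1 x, f2 x).
have -> : f1 @: D = fst @: (g @: D) by rewrite -imset_comp; apply: eq_imset.
have -> : f2 @: D = snd @: (g @: D) by rewrite -imset_comp; apply: eq_imset.
rewrite (card_in_imset (f := fst)) ?(card_in_imset (f := snd)) // =>
  p q /imsetP[x Dx ->{p}] /imsetP[y Dy ->{q}] /= eqxy.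
  by congr pair => //; apply/eqP; rewrite eqf ?eqxy.
by congr pair => //; apply/eqP; rewrite -eqf ?eqxy.
Qed.

Lemma card_equivalence_partition (T S : finType) (R : rel T) (f : T -> S) :
  (forall x y, R x y = (f x == f y)) ->
  #|equivalence_partition R [set: T]| = #|f @: [set: T]|.
Proof.
move=> Rf; apply: eq_card_imset_kernel => x y _ _.
apply/eqP/eqP => [/setP/(_ y)|fxy]; last by apply/setP=> z; rewrite !inE !Rf fxy.
by rewrite !inE !Rf eqxx => /eqP.
Qed.

Lemma card_imset_pair (T S1 S2 : finType) (f1 : T -> S1) (f2 : T -> S2) :
  #|[set (f1 x, f2 x) | x in [set: T]]| = \sum_a #|f2 @: [set x | f1 x == a]|.
Proof.
rewrite -sum1_card (partition_big fst predT) //=; apply: eq_bigr => a _.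
rewrite sum1dep_card (_ : finset _ = [set (f1 x, f2 x) | x in [set x | f1 x == a]]).
  apply: eq_card_imset_kernel => x y; rewrite !inE => /eqP fx /eqP fy.
  by rewrite xpair_eqE fx fy eqxx.
apply/setP=> p; rewrite !inE; apply/andP/imsetP.
  by case=> /imsetP[x _ ->] /= fx; exists x; rewrite ?inE.
by case=> x; rewrite inE => fx -> ; split=> //; apply: imset_f.
Qed.

(** * Indegrees and cycle reversals *)

Section Indegree.

Variable G : multigraph.
Local Notation V := (vertex G).
Local Notation E := (edge G).
Implicit Types (O : partial_orientation G) (e : E) (u v x y : V).

Definition ehead O e : option V := omap (fun b => dhead (e, b)) (O e).

Definition indeg O v : nat := \sum_e (ehead O e == Some v).

Definition support O : {set E} := [set e | isSome (O e)].

Definition sub_darts O (c : seq (dart G)) := all [pred d | O d.1 == Some d.2] c.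

(** Exchanging the sums turns the total indegree of a set of vertices into the
number of edges that point into it; this also handles contractions, where the
set is the preimage of a vertex. *)
Lemma sum_indeg O (R : pred V) :
  \sum_(x | R x) indeg O x = \sum_e oapp R false (ehead O e).
Proof.
rewrite exchange_big; apply: eq_bigr => e _ /=.
case: (ehead O e) => [z|] /=; last by rewrite big1.
have [Rz | nRz] := boolP (R z).
  by rewrite (bigD1 z) //= eqxx big1 // => x /andP[_ /negbTE]; rewrite eq_sym => xz;
    rewrite (inj_eq Some_inj) xz.
by rewrite big1 // => x Rx; case: eqP => // -[zx]; rewrite zx Rx in nRz.
Qed.

(** The orientation is determined by the edge, so darts of O with distinct
tails cannot share an edge.  Paths and cycles found with distinct vertices
therefore come with distinct edges, including cycles of length 1 and 2. *)
Lemma sub_darts_uniq O c :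
  sub_darts O c -> uniq (map (@dtail G) c) -> uniq [seq d.1 | d <- c].
Proof.
move=> /allP Oc /map_uniq Uc; rewrite map_inj_in_uniq // => -[e b] [e' b'].
by move=> /Oc/eqP /= Oe /Oc/eqP /= Oe' /= ee'; move: Oe'; rewrite -ee' Oe => -[->].
Qed.

(** Reversal swaps heads and tails of the darts of c.  The two multisets agree
when c is a cycle and differ only by the two ends when c is a path; both cases
are used.  The additive form avoids subtractions. *)
Lemma indeg_reverse O c v :
    sub_darts O c -> uniq [seq d.1 | d <- c] ->
  indeg (reverse_cycle O c) v + count_mem v (map (@dhead G) c) =
  indeg O v + count_mem v (map (@dtail G) c).
Proof.
move=> /allP Oc Uc.
pose inc e := e \in [seq d.1 | d <- c].
have split_indeg O' : indeg O' v =
    \sum_(d <- c) (ehead O' d.1 == Some v) + \sum_(e | ~~ inc e) (ehead O' e == Some v).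
  rewrite /indeg (bigID inc) /= -big_uniq //= big_map //.
have count_sum (f : dart G -> V) : count_mem v (map f c) = \sum_(d <- c) (f d == v).
  by rewrite -sum1_count big_map big_mkcond.
rewrite !split_indeg !count_sum addnAC [RHS]addnAC; congr (_ + _); last first.
  by apply: eq_bigr => e; rewrite /inc /ehead ffunE => /negbTE->.
rewrite addnC; congr (_ + _); apply: eq_big_seq => d cd.
  by rewrite /ehead (eqP (Oc d cd)); case: (d).
rewrite /ehead ffunE map_f // (eqP (Oc d cd)) /= /dhead /dtail /=.
by case: (d.2).
Qed.

Lemma support_reverse O c : support (reverse_cycle O c) = support O.
Proof.
by apply/setP=> e; rewrite !inE ffunE; case: ifP => // _; case: (O e).
Qed.

Lemma dart_pathE d c :
  path [rel d1 d2 : dart G | dhead d1 == dtail d2] d c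
    = (map (@dhead G) (belast d c) == map (@dtail G) c).
Proof. by elim: c d => //= d1 c IHc d; rewrite eqseq_cons IHc. Qed.

Lemma cycle_reversal_indeg O O' :
  cycle_reversal O O' -> support O = support O' /\ indeg O =1 indeg O'.
Proof.
case/existsP=> c /andP[/andP[/and4P[c0 Cc Uc Uec] Oc] /eqP->].
split=> [|v]; first by rewrite support_reverse.
have := indeg_reverse v Oc Uec.
suff -> : count_mem v (map (@dhead G) c) = count_mem v (map (@dtail G) c).
  by move/addIn->.
have: perm_eq (map (@dhead G) c) (map (@dtail G) c).
  case: (bseqval c) c0 Cc => // d p _.
  by rewrite /cycle dart_pathE belast_rcons => /eqP->; rewrite map_rcons perm_rcons.
by move/permP.
Qed.

Definition diff_arc O O' : rel V :=
  [rel x y | [exists d : dart G, [&& O d.1 == Some d.2, O d.1 != O' d.1,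
                                     dtail d == x & dhead d == y]]].

(** An edge that points into the set reached from x in O' does so in O as well:
if O orients it the other way, its tail in O is reachable, and so is its head. *)
Lemma reach_head O O' x e : support O = support O' ->
  oapp (connect (diff_arc O O') x) false (ehead O' e) ->
  oapp (connect (diff_arc O O') x) false (ehead O e).
Proof.
move=> /setP/(_ e); rewrite !inE /ehead.
case Oe: (O e) => [b|]; case O'e: (O' e) => [b'|] //= _.
have [-> // | bb' /connect_trans] := eqVneq b b'; apply; apply: connect1.
apply/existsP; exists (e, b); rewrite /= Oe O'e eqxx (inj_eq Some_inj) bb' /=.
by move: bb'; rewrite /dtail /dhead /=; case: (b) (b') => [] [] // _; rewrite !eqxx.
Qed.

(** Among the orientations with the same support, O has the largest total
indegree on the set reached from x: this is the cut argument that produces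
paths of differing edges. *)
Lemma reach_indeg_leq O O' x : support O = support O' ->
  \sum_(y | connect (diff_arc O O') x y) indeg O' y
    <= \sum_(y | connect (diff_arc O O') x y) indeg O y.
Proof.
move=> sOO'; rewrite !sum_indeg; apply: leq_sum => e _.
by case: (oapp _ _ _) (reach_head (x := x) (e := e) sOO') => // ->.
Qed.

(** If the tail of e were out of reach of its head, e would point into the set
reached from its head in O but not in O'; that set would then have larger total
indegree in O, contrary to the equality of indegrees. *)
Lemma diff_arc_return O O' e b : support O = support O' -> indeg O =1 indeg O' ->
  O e = Some b -> O e != O' e ->
  connect (diff_arc O O') (dhead (e, b)) (dtail (e, b)).
Proof.
move=> sOO' dOO' Oe O'e; set x := dhead _.
have eO : ehead O e = Some x by rewrite /ehead Oe.
have eO' : ehead O' e = Some (dtail (e, b)).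
  move: O'e; move/setP/(_ e): sOO'; rewrite !inE /ehead Oe.
  by case: (O' e) => // b' _; rewrite (inj_eq Some_inj) /dtail /dhead; case: (b) (b') => [] [].
apply/contraT=> nR.
have: \sum_(y | connect (diff_arc O O') x y) indeg O y
    = \sum_(y | connect (diff_arc O O') x y) indeg O' y by apply: eq_bigr.
rewrite !sum_indeg (bigD1 e) // [RHS](bigD1 e) //= eO eO' /= connect0 (negbTE nR).
move=> sumE; have: \sum_(f | f != e) oapp (connect (diff_arc O O') x) false (ehead O' f)
    <= \sum_(f | f != e) oapp (connect (diff_arc O O') x) false (ehead O f).
  apply: leq_sum => f _.
  by case: (oapp _ _ (ehead O' f)) (reach_head (x := x) (e := f) sOO') => // ->.
by move: sumE; rewrite add1n add0n => <-; rewrite ltnn.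
Qed.

Lemma diff_arc_darts O O' x p : path (diff_arc O O') x p ->
  exists c : seq (dart G),
    [/\ sub_darts O c, all [pred d | O d.1 != O' d.1] c,
        map (@dtail G) c = belast x p & map (@dhead G) c = p].
Proof.
elim: p x => [|y p IHp] x /=; first by exists [::].
case/andP=> /existsP[d /and4P[Od O'd /eqP dx /eqP dy]] /IHp[c [Oc O'c ct ch]].
by exists (d :: c); rewrite /= Od O'd Oc O'c ct ch dx dy.
Qed.

Definition diff O O' : {set E} := [set e | O e != O' e].

(** The directed cycle consists of a differing edge e and a simple path of
differing edges from the head of e back to its tail.  An edge has only two
orientations, so reversing it makes O agree with O' along the whole cycle. *)
Lemma cycle_reversal_closer O O' :
    support O = support O' -> indeg O =1 indeg O' -> O != O' ->
  exists2 O1, cycle_reversal O O1 & #|diff O1 O'| < #|diff O O'|.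
Proof.
move=> sOO' dOO' neq.
have [e O'e] : exists e, O e != O' e.
  apply/existsP; apply: contraR neq => /existsPn eqO.
  by apply/eqP/ffunP => e; apply/eqP; have := eqO e; rewrite negbK.
case Oe: (O e) => [b|]; last first.
  by move/setP/(_ e): sOO' O'e; rewrite !inE Oe; case: (O' e).
have /connectP[p0] := diff_arc_return sOO' dOO' Oe O'e.
case/shortenP=> p path_p Up _ last_p {p0}.
have [c [Oc O'c ct ch]] := diff_arc_darts path_p.
pose c1 := rcons c (e, b).
have tails : map (@dtail G) c1 = dhead (e, b) :: p.
  by rewrite map_rcons ct last_p -lastI.
have Oc1 : sub_darts O c1 by rewrite /sub_darts all_rcons /= Oe eqxx.
have Uc1 : uniq [seq d.1 | d <- c1] by apply: (sub_darts_uniq Oc1); rewrite tails.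
have O'c1 : all [pred d | O d.1 != O' d.1] c1 by rewrite all_rcons /= O'e.
have size_c1 : size c1 <= #|E|.
  by rewrite -(size_map fst) -(card_uniqP Uc1) max_card.
have cycle_c1 : cycle [rel d d' | dhead d == dtail d'] c1.
  by rewrite /c1 -rot1_cons rot_cycle /cycle dart_pathE belast_rcons /= tails ch.
exists (reverse_cycle O c1).
  apply/existsP; exists (Bseq size_c1); rewrite /directed_cycle /graph_cycle eqxx andbT /=.
  rewrite cycle_c1 tails Up Uc1 -/(sub_darts O c1) Oc1 !andbT.
  by rewrite -size_eq0 size_rcons.
apply: proper_card; apply/properP; split.
  apply/subsetP=> f; rewrite !inE ffunE; case: ifP => // /mapP[d c1d ->] _.
  exact: (allP O'c1).
have c1e : e \in [seq d.1 | d <- c1] by apply/mapP; exists (e, b); rewrite ?mem_rcons ?mem_head.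
exists e; rewrite !inE ?ffunE ?c1e //.
move: O'e; move/setP/(_ e): sOO'; rewrite !inE Oe negbK.
by case: (O' e) => // -[] _ ; case: (b).
Qed.

(** Support and indegrees form a complete invariant: by
[cycle_reversal_closer], reversals decrease the number of edges on which O
disagrees with O' until it vanishes. *)
Lemma cycle_reversal_equivE O O' :
  cycle_reversal_equiv O O' =
    (support O == support O') && [forall v, indeg O v == indeg O' v].
Proof.
apply/idP/andP=> [/connectP[p]|[/eqP sOO' /forallP dOO']].
  elim: p O => [|O1 p IHp] O /= => [_ ->|/andP[O1O /IHp{}IHp] /IHp[/eqP<- /forallP dO1]].
    by split=> //; apply/forallP.
  have [-> dO] : support O = support O1 /\ indeg O =1 indeg O1.
    case/orP: O1O => /cycle_reversal_indeg[-> dO]; split=> // v; by rewrite dO.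
  by split=> //; apply/forallP=> v; rewrite dO.
have {}dOO' : indeg O =1 indeg O' by move=> v; apply/eqP.
have [n] := ubnP #|diff O O'|; elim: n O sOO' dOO' => // n IHn O sOO' dOO' leOn.
have [-> | neq] := eqVneq O O'; first exact: connect0.
have [O1 revO1 ltO1] := cycle_reversal_closer sOO' dOO' neq.
have [sO1 dO1] := cycle_reversal_indeg revO1.
apply: connect_trans (connect1 _) (IHn O1 _ _ _); rewrite /= ?revO1 //.
- by rewrite -sO1.
- by move=> v; rewrite -dO1.
exact: leq_trans ltO1 leOn.
Qed.

(** Convexity of the set of indegree vectors: if a vector of the same support
can be reached by moving indegree from v towards u (and possibly increasing
other entries), then one unit can be moved from v to u.  The set reached from u
must contain v, as otherwise its total indegree would be larger in O' than in
O; reversing a path from u to v does the move. *)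
Lemma indeg_exchange O O' u v : support O = support O' ->
    (forall x, x != v -> indeg O x <= indeg O' x) ->
    u != v -> indeg O u < indeg O' u ->
  exists2 O1, support O1 = support O &
    forall x, indeg O1 x + (x == v) = indeg O x + (x == u).
Proof.
move=> sOO' dOO' uv ltu.
have /connectP[p0] : connect (diff_arc O O') u v.
  apply: contraLR (reach_indeg_leq u sOO') => nR; rewrite -ltnNge.
  rewrite (bigD1 u) ?connect0 //= [X in _ < X](bigD1 u) ?connect0 //= -addSn leq_add //.
  apply: leq_sum => x /andP[Rx _]; apply: dOO'.
  by apply: contraNneq nR => <-.
case/shortenP=> p path_p Up _ last_p {p0}.
have [c [Oc O'c ct ch]] := diff_arc_darts path_p.
have Uc : uniq [seq d.1 | d <- c].
  apply: (sub_darts_uniq Oc); rewrite ct.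
  by move: Up; rewrite lastI rcons_uniq => /andP[].
exists (reverse_cycle O c); first exact: support_reverse.
move=> x; have := indeg_reverse x Oc Uc; rewrite ct ch.
have: count_mem x (u :: p) = count_mem x (rcons (belast u p) v) by rewrite last_p -lastI.
rewrite -cats1 count_cat /= addn0 ![_ == x]eq_sym; lia.
Qed.

Definition orient O e b : partial_orientation G :=
  [ffun f => if f == e then Some b else O f].

Lemma support_orient O e b : support (orient O e b) = e |: support O.
Proof. by apply/setP=> f; rewrite !inE ffunE; case: eqP. Qed.

Lemma indeg_orient O e b v :
  e \notin support O -> indeg (orient O e b) v = indeg O v + (dhead (e, b) == v).
Proof.
rewrite inE => Oe; rewrite /indeg !(bigD1 e (P := predT)) //= {1 3}/ehead ffunE eqxx.
case: (O e) Oe => //= _; rewrite add0n addnC (inj_eq Some_inj); congr (_ + _).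
by apply: eq_bigr => f /negbTE fe; rewrite /ehead ffunE fe.
Qed.

Lemma orient_supportU1 (A : {set E}) e : e \notin A ->
  [set O | support O == e |: A] =
  (fun O => orient O e true) @: [set O | support O == A]
    :|: (fun O => orient O e false) @: [set O | support O == A].
Proof.
move=> Ae; apply/setP=> O; rewrite in_setU inE; apply/eqP/orP=> [sO | ]; last first.
  by case=> /imsetP[O1]; rewrite inE => /eqP sO1 ->; rewrite support_orient sO1.
pose O1 : partial_orientation G := [ffun f => if f == e then None else O f].
have sO1 : support O1 == A.
  apply/eqP/setP=> f; move/setP/(_ f): sO; rewrite !inE ffunE.
  by case: eqP => [->|] //; rewrite (negbTE Ae).
have O1E b : O e = Some b -> O = orient O1 e b.
  by move=> Oe; apply/ffunP=> f; rewrite !ffunE; case: eqP => [->|].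
have := setU11 e A; rewrite -sO inE; case Oe: (O e) => [b|] // _.
by case: b Oe => /O1E->; [left | right]; apply/imsetP; exists O1; rewrite ?inE.
Qed.

(** The indegree vector, packed in a finite type so that its values can be
counted; the bound holds because a vertex has indegree at most #|E|. *)
Definition score O : {ffun V -> 'I_#|E|.+1} := [ffun v => inord (indeg O v)].

Lemma score_eqP O O' : reflect (indeg O =1 indeg O') (score O == score O').
Proof.
have dE O1 v : indeg O1 v < #|E|.+1.
  rewrite ltnS -sum1_card; apply: leq_sum => e _; exact: leq_b1.
apply: (iffP eqP) => [/ffunP eqO v|eqO]; last by apply/ffunP=> v; rewrite !ffunE eqO.
by have /(congr1 (@nat_of_ord _)) := eqO v; rewrite !ffunE !inordK.
Qed.

Definition scores (A : {set E}) := score @: [set O | support O == A].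

Lemma card_cycle_reversal_classes : #|cycle_reversal_classes G| = \sum_A #|scores A|.
Proof.
rewrite -card_imset_pair; apply: card_equivalence_partition => O O' /=.
rewrite cycle_reversal_equivE xpair_eqE; congr (_ && _).
by apply/forallP/score_eqP => dO v; apply/eqP.
Qed.

End Indegree.

(** * Contraction *)

Section Contraction.

Variables (G : multigraph) (e : edge G).
Local Notation V := (vertex G).
Local Notation E := (edge G).
Implicit Types (O : partial_orientation G) (A : {set E}).

Definition collapse (v : V) : V := if v == tgt e then src e else v.

(** Contraction keeps the types of vertices and edges, so that sets of edges
and partial orientations of G are literally those of the contraction.  The
target of e remains as an isolated vertex and e becomes a loop. *)
Definition contract : multigraph :=
  Multigraph (fun f => collapse (src f)) (fun f => collapse (tgt f)).

Lemma indeg_contract O v :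
  @indeg contract O v = \sum_(x | collapse x == v) indeg O x.
Proof.
rewrite sum_indeg; apply: eq_bigr => f _.
by rewrite /ehead; case: (O f) => [[]|].
Qed.

Lemma indeg_contract_src O : src e != tgt e ->
  @indeg contract O (src e) = indeg O (src e) + indeg O (tgt e).
Proof.
move=> nl; rewrite indeg_contract (bigD1 (src e)) /= ?/collapse ?(negbTE nl) //.
rewrite (bigD1 (tgt e)) /= ?eqxx 1?eq_sym // big1 ?addn0 // => x.
by case: (x == tgt e); rewrite ?andbF // andbT; case: eqP.
Qed.

Lemma indeg_contract_other O v : src e != v -> tgt e != v ->
  @indeg contract O v = indeg O v.
Proof.
move=> sv tv; rewrite indeg_contract (big_pred1 v) // => x; rewrite /collapse.
by case: (eqVneq x (tgt e)) => [->|] //=; rewrite (negbTE sv) (negbTE tv).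
Qed.

Lemma indeg_contract_tgt O : src e != tgt e -> @indeg contract O (tgt e) = 0.
Proof.
move=> nl; rewrite indeg_contract big_pred0 // => x; rewrite /collapse.
by case: ifP => //; rewrite (negbTE nl).
Qed.

(** Contracting e remembers everything of the indegree vector but how the sum
at the ends of e is shared between them. *)
Lemma score_contractP O O' : src e != tgt e ->
  reflect ((forall v, src e != v -> tgt e != v -> indeg O v = indeg O' v) /\
           indeg O (src e) + indeg O (tgt e) = indeg O' (src e) + indeg O' (tgt e))
          (@score contract O == @score contract O').
Proof.
move=> nl; apply: (iffP (score_eqP _ _)) => [dO | [dO dOe] v].
  split=> [v sv tv|]; first by rewrite -!indeg_contract_other.
  by rewrite -!indeg_contract_src.
have [<-|sv] := eqVneq (src e) v; first by rewrite !indeg_contract_src.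
have [<-|tv] := eqVneq (tgt e) v; first by rewrite !indeg_contract_tgt.
by rewrite !indeg_contract_other // dO.
Qed.

Variable A : {set E}.
Hypothesis Ae : e \notin A.

Local Notation X := [set O : partial_orientation G | support O == A].

Lemma score_orient_eq b O O' : O \in X -> O' \in X ->
  (score (orient O e b) == score (orient O' e b)) = (score O == score O').
Proof.
rewrite !inE => /eqP sO /eqP sO'.
apply/score_eqP/score_eqP=> dO v; last by rewrite !indeg_orient ?sO ?sO' ?dO.
by have := dO v; rewrite !indeg_orient ?sO ?sO' // => /addIn.
Qed.

Lemma scoresU1 : scores (e |: A) =
  (fun O => score (orient O e true)) @: X :|: (fun O => score (orient O e false)) @: X.
Proof. by rewrite /scores orient_supportU1 // imsetU -!imset_comp. Qed.

Lemma card_scoresU1_loop : src e = tgt e -> #|scores (e |: A)| = #|scores A|.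
Proof.
move=> loop; rewrite scoresU1.
rewrite (_ : (fun O => score (orient O e false)) @: X = (fun O => score (orient O e true)) @: X).
  rewrite setUid; apply: eq_card_imset_kernel => O O' OX O'X; exact: score_orient_eq.
apply: eq_in_imset => O; rewrite inE => /eqP sO; apply/eqP/score_eqP => v.
by rewrite !indeg_orient ?sO // /dhead /= loop.
Qed.

(** The orientations of A which give a new vector when e is directed towards
its source.  They are those whose indegree vector is at the end of its fibre
under contraction, the one with the largest entry at the source of e. *)
Let topmost := [set O in X |
  score (orient O e false) \notin (fun O => score (orient O e true)) @: X].

Lemma not_topmostP O : O \in X -> reflect
  (exists2 O1, O1 \in X & forall v, indeg O1 v + (v == tgt e) = indeg O v + (v == src e))
  (O \notin topmost).
Proof.
move=> OX; have sO : support O = A by apply/eqP; move: OX; rewrite inE.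
rewrite inE OX negbK /=.
apply: (iffP imsetP) => -[O1 O1X dO]; exists O1 => //;
  have sO1 : support O1 = A by apply/eqP; move: O1X; rewrite inE.
  move=> v; move/eqP/score_eqP/(_ v): dO; rewrite !indeg_orient ?sO ?sO1 //.
  by rewrite /dhead /= ![_ == v]eq_sym.
apply/eqP/score_eqP=> v; rewrite !indeg_orient ?sO ?sO1 // /dhead /=.
by rewrite ![_ == v]eq_sym dO.
Qed.

(** A fibre of the contraction has only one topmost vector: if O and O' are in
the same fibre and O has the smaller indegree at the source of e,
[indeg_exchange] moves one unit from the target to the source, so O is not
topmost. *)
Lemma topmost_score_contract O O' : src e != tgt e -> O \in topmost -> O' \in topmost ->
  (score O == score O') = (@score contract O == @score contract O').
Proof.
move=> nl Ot O't; apply/idP/idP=> [/score_eqP dO | ].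
  by apply/score_contractP => //; split=> [v _ _|]; rewrite !dO.
wlog leO : O O' Ot O't / indeg O (src e) <= indeg O' (src e).
  move=> IH; have [/IH|/ltnW/IH{}IH] := leqP (indeg O (src e)) (indeg O' (src e)).
    exact.
  by rewrite eq_sym [score O == _]eq_sym; apply: IH.
case/score_contractP=> // dO dOe; apply/score_eqP=> v.
have OX : O \in X by case/setIdP: Ot.
have sO : support O = A by apply/eqP; move: OX; rewrite inE.
have sO' : support O' = A by move: O't; rewrite !inE => /andP[/eqP].
move: leO; rewrite leq_eqVlt => /orP[/eqP eqs | lts].
  move: dOe; rewrite eqs => /addnI dOe.
  have [<-|sv] := eqVneq (src e) v => //.
  have [<-|tv] := eqVneq (tgt e) v => //.
  exact: dO.
have [|x xt|//|//|O1 sO1 dO1] := @indeg_exchange G O O' (src e) (tgt e).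
- by rewrite sO.
- have [->|sx] := eqVneq x (src e); first exact: ltnW.
  by rewrite dO // eq_sym.
have /negP[] : O \notin topmost; last exact: Ot.
apply/(not_topmostP OX); exists O1; first by rewrite inE sO1 sO.
exact: dO1.
Qed.

(** Every fibre has a topmost vector: take the largest entry at the source of
e in the fibre. *)
Lemma scores_contract_topmost : src e != tgt e ->
  @score contract @: topmost = @scores contract A.
Proof.
move=> nl; apply/eqP; rewrite eqEsubset; apply/andP; split.
  by apply/imsetS/subsetP=> O /setIdP[].
apply/subsetP=> _ /imsetP[O OX ->].
pose P O' := (O' \in X) && (@score contract O' == @score contract O).
have PO : P O by rewrite /P OX eqxx.
case: (arg_maxnP (fun O' => indeg O' (src e)) PO) => O' /andP[O'X sO'] maxO'.
apply/imsetP; exists O'; last by rewrite (eqP sO').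
apply/contraT=> /(not_topmostP O'X)[O1 O1X dO1].
have /maxO' : P O1.
  rewrite /P O1X -(eqP sO'); apply/score_contractP => //; split=> [v sv tv|].
    by have := dO1 v; rewrite ![v == _]eq_sym (negbTE sv) (negbTE tv) !addn0.
  have := dO1 (src e); have := dO1 (tgt e).
  by rewrite !eqxx [tgt e == _]eq_sym (negbTE nl); lia.
by have := dO1 (src e); rewrite eqxx (negbTE nl) addn0 addn1 => ->; rewrite /= ltnn.
Qed.

(** Directing e towards its target translates the vectors of A.  The vectors
missed by this translate come from the topmost orientations, which contraction
puts in bijection with the vectors of the contraction. *)
Lemma card_scoresU1 : src e != tgt e ->
  #|scores (e |: A)| = #|scores A| + #|@scores contract A|.
Proof.
move=> nl; pose f1 O := score (orient O e true); pose f2 O := score (orient O e false).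
rewrite (_ : scores (e |: A) = f1 @: X :|: f2 @: X); last exact: scoresU1.
have -> : f1 @: X :|: f2 @: X = f1 @: X :|: f2 @: topmost.
  apply/setP=> s; rewrite !in_setU; have [//|/= s1] := boolP (s \in f1 @: X).
  apply/imsetP/imsetP=> -[O OX sE]; exists O => //; last by case/setIdP: OX.
  by rewrite inE OX -/(f2 O) -sE.
rewrite cardsU disjoint_setI0 ?cards0 ?subn0.
  congr (_ + _).
    by apply: eq_card_imset_kernel => O O' OX O'X; apply: score_orient_eq.
  rewrite -scores_contract_topmost //; apply: eq_card_imset_kernel => O O' Ot O't.
  rewrite -topmost_score_contract //; apply: score_orient_eq.
    by case/setIdP: Ot.
  by case/setIdP: O't.
rewrite disjoint_sym disjoint_subset; apply/subsetP=> _ /imsetP[O /setIdP[_ Ot] ->].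
by rewrite inE.
Qed.

End Contraction.

(** * Components and forests *)

Section Components.

Variable G : multigraph.
Local Notation V := (vertex G).
Local Notation E := (edge G).
Implicit Types (A : {set E}) (e : E).

Lemma adj_connect_sym A : connect_sym (adj A).
Proof.
apply: sym_connect_sym => x y.
by apply: eq_existsb => e; rewrite orbC.
Qed.

Lemma adj_edge A e : e \in A -> adj A (src e) (tgt e).
Proof. by move=> Ae; apply/existsP; exists e; rewrite Ae !eqxx. Qed.

Lemma sub_adj A (B : {set E}) : A \subset B -> subrel (adj A) (adj B).
Proof.
move=> /subsetP AB x y /existsP[e /andP[/AB Be xy]].
by apply/existsP; exists e; rewrite Be.
Qed.

Lemma ncomponents_leq A : ncomponents A <= #|V|.
Proof. exact: max_card. Qed.

Lemma ncomponents_gt0 A : 0 < #|V| -> 0 < ncomponents A.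
Proof.
case/card_gt0P=> x _; apply/card_gt0P; exists (fingraph.root (adj A) x).
by rewrite !inE andbT; apply: roots_root; apply: adj_connect_sym.
Qed.

Lemma ncomponents0 : ncomponents (set0 : {set E}) = #|V|.
Proof.
apply: eq_card => x; rewrite !inE andbT.
have /connectP[[|y p] /=] := connect_root (adj (set0 : {set E})) x.
  by move=> _ rx; rewrite /in_mem /= /roots rx eqxx.
by case/andP=> /existsP[e]; rewrite inE.
Qed.

Lemma ncomponentsU1_loop A e : src e = tgt e -> ncomponents (e |: A) = ncomponents A.
Proof.
move=> loop; apply: eq_n_comp; have sAe := sub_adj (subsetUr [set e] A).
move=> x y; apply/idP/idP; last by apply: connect_sub => ? ? /sAe /connect1.
apply: connect_sub => {}x {}y /existsP[f /andP[/setU1P[-> | Af] xy]].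
  by case/orP: xy => /andP[/eqP<- /eqP<-]; rewrite loop connect0.
by apply: connect1; apply/existsP; exists f; rewrite Af.
Qed.

End Components.

(** Two vertices are connected by F + e exactly when their images are connected
by F in the contraction; the extra component of the contraction is the isolated
target of e. *)
Lemma ncomponents_contract (G : multigraph) (F : {set edge G}) (e : edge G) :
  src e != tgt e ->
  @ncomponents (contract e) F = (ncomponents (e |: F)).+1.
Proof.
move=> nl; pose c := collapse e; set a' := @adj (contract e) F; set a := adj (e |: F).
have ct x : c x != tgt e by rewrite /c /collapse; case: ifP => // /negbT.
have a'_tgt x y : a' x y -> (x != tgt e) && (y != tgt e).
  by case/existsP=> f /andP[_ /orP[]/andP[/eqP<- /eqP<-]]; rewrite !ct.
have conn_c x : connect a x (c x).
  rewrite /c /collapse; case: eqP => [->|_]; last exact: connect0.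
  by rewrite adj_connect_sym; apply/connect1/adj_edge/setU11.
have sym_a : connect_sym a by apply: adj_connect_sym.
have sym_a' : connect_sym a' by apply: adj_connect_sym.
have conn_F (f : edge G) : f \in F -> connect a (c (src f)) (c (tgt f)).
  move=> Ff; have {}Ff : connect a (src f) (tgt f).
    by apply/connect1/adj_edge; rewrite inE Ff orbT.
  by apply: connect_trans (connect_trans Ff (conn_c _)); rewrite sym_a conn_c.
have a'_a x y : connect a' x y -> connect a x y.
  apply: connect_sub => {}x {}y /existsP[f /andP[/conn_F Ff]] /=.
  by case/orP=> /andP[/eqP<- /eqP<-] //; rewrite sym_a.
have a_a' x y : a x y -> connect a' (c x) (c y).
  case/existsP=> f /andP[/setU1P[-> | Ff] xy].
    have cse : c (src e) = c (tgt e) by rewrite /c /collapse eqxx (negbTE nl).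
    by case/orP: xy => /andP[/eqP<- /eqP<-]; rewrite cse.
  apply: connect1; apply/existsP; exists f; rewrite Ff /=.
  by case/orP: xy => /andP[/eqP<- /eqP<-]; rewrite !eqxx ?orbT.
have conn_a' x y : connect a x y -> connect a' (c x) (c y).
  case/connectP=> p path_p ->; elim: p x path_p => //= z p IHp x /andP[/a_a' xz /IHp].
  exact: connect_trans.
rewrite /ncomponents [LHS](@n_compC (vertex (contract e)) (predC1 (tgt e))) -[RHS]addn1.
(* The vertices other than the target of e, then the target alone. *)
congr (_ + _).
  rewrite (@adjunction_n_comp _ _ c _ a) //.
  - by apply: eq_n_comp_r => x; rewrite !inE ct.
  - by move=> x y /a'_tgt /andP[xt yt]; rewrite !inE xt yt.
  split=> [x | x y _].
    rewrite !inE => xt; exists x.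
    by rewrite /c /collapse (negbTE xt) connect0.
  apply/idP/idP=> [|/a'_a xy]; first exact: conn_a'.
  apply: connect_trans (conn_c x) (connect_trans xy _).
  by rewrite sym_a.
rewrite -(n_comp_connect sym_a' (tgt e)); apply: eq_n_comp_r => x; rewrite !inE negbK.
apply/eqP/idP=> [->|/connectP[[|y p] //=]]; first exact: connect0.
by case/andP=> /a'_tgt; rewrite eqxx.
Qed.

(** Acyclicity, in the form in which it appears in the nullity exponent of the
Tutte polynomial: the truncated nullity #|F| - rank F vanishes. *)
Definition forest (G : multigraph) (F : {set edge G}) : bool := #|F| <= rank F.

Lemma card_leq_ncomponents (G : multigraph) (F : {set edge G}) :
  #|vertex G| <= ncomponents F + #|F|.
Proof.
have [n] := ubnP #|F|; elim: n G F => // n IHn G F leFn.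
have [->|[e Fe]] := set_0Vmem F; first by rewrite ncomponents0 leq_addr.
move: leFn; rewrite -(setD1K Fe) cardsU1 setD11 add1n ltnS => leFn.
have [loop | nl] := eqVneq (src e) (tgt e).
  by rewrite (ncomponentsU1_loop _ loop) addnS leqW // IHn.
by have := IHn (contract e) _ leFn; rewrite (ncomponents_contract _ nl) addSnnS.
Qed.

Lemma rank_leq_card (G : multigraph) (F : {set edge G}) : rank F <= #|F|.
Proof. by rewrite leq_subLR card_leq_ncomponents. Qed.

Lemma forest0 (G : multigraph) : @forest G set0.
Proof. by rewrite /forest cards0. Qed.

(** Contracting a non-loop lowers the rank by one, while a loop does not raise
the rank and so always creates positive nullity. *)
Lemma forestU1 (G : multigraph) (F : {set edge G}) (e : edge G) : e \notin F ->
  forest (e |: F) = (src e != tgt e) && @forest (contract e) F.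
Proof.
move=> Fe; rewrite /forest cardsU1 Fe add1n; have [loop | nl] := eqVneq.
  by rewrite /rank ncomponentsU1_loop // ltnNge rank_leq_card.
have := ncomponents_contract F nl; have := @ncomponents_leq (contract e) F.
rewrite /rank /=; lia.
Qed.

Lemma card_subsetsU1 (T : finType) (P : pred {set T}) (A : {set T}) x : x \notin A ->
  #|[set F : {set T} | (F \subset x |: A) && P F]|
    = #|[set F : {set T} | (F \subset A) && P F]|
      + #|[set F : {set T} | (F \subset A) && P (x |: F)]|.
Proof.
move=> Ax; rewrite -(cardsID [set F : {set T} | x \notin F]); congr (_ + _).
  apply: eq_card => F; rewrite !inE andbAC; congr (_ && _).
  apply/andP/idP=> [[/subsetP FA Fx] | FA].
    by apply/subsetP=> y Fy; have /setU1P[yx | //] := FA y Fy; rewrite -yx Fy in Fx.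
  by split; [apply: subset_trans FA (subsetUr _ _) | apply: contra Ax; apply: (subsetP FA)].
rewrite -[RHS](card_in_imset (f := fun F => x |: F)) => [|F F'].
  apply: eq_card => F; rewrite !inE negbK; apply/and3P/imsetP=> [[Fx FA PF]|[F']].
    exists (F :\ x); last by rewrite setD1K.
    by rewrite inE setD1K // PF subDset FA.
  by rewrite inE => /andP[F'A PF'] ->; rewrite setU11 setUS.
rewrite !inE => /andP[FA _] /andP[F'A _] /(congr1 (fun B => B :\ x)).
by rewrite !setU1K //; apply: contra Ax; apply/subsetP.
Qed.

(** Deletion-contraction on both sides.  The graph is generalized in the
induction, since the recurrence for A + e involves A in the contraction. *)
Lemma card_scores (G : multigraph) (A : {set edge G}) :
  #|scores A| = #|[set F : {set edge G} | (F \subset A) && forest F]|.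
Proof.
have [n] := ubnP #|A|; elim: n G A => // n IHn G A leAn.
have [->|[e Ae]] := set_0Vmem A.
  transitivity 1%N.
    rewrite /scores (_ : finset _ = [set [ffun=> None]]) ?imset_set1 ?cards1 //.
    apply/setP=> O; rewrite !inE; apply/eqP/eqP=> [/setP O0 | ->].
      by apply/ffunP=> e; have := O0 e; rewrite !inE ffunE; case: (O e).
    by apply/setP=> e; rewrite !inE ffunE.
  rewrite (_ : finset _ = [set set0]) ?cards1 //; apply/setP=> F.
  by rewrite !inE subset0; case: eqP => // ->; rewrite forest0.
have eB : e \notin A :\ e by rewrite setD11.
move: leAn; rewrite -(setD1K Ae); set B := A :\ e in eB *.
rewrite cardsU1 eB add1n ltnS => leBn.
rewrite card_subsetsU1 //.
have fU1 (F : {set edge G}) : (F \subset B) && forest (e |: F)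
    = (src e != tgt e) && ((F \subset B) && @forest (contract e) F).
  have [FB|] := boolP (F \subset B); last by rewrite andbF.
  by rewrite forestU1 //; apply: contra eB; apply/subsetP.
have [loop | nl] := eqVneq (src e) (tgt e).
  rewrite (card_scoresU1_loop eB loop) IHn // [X in _ + X]eq_card0 ?addn0 // => F.
  by rewrite !inE fU1 loop eqxx.
rewrite (card_scoresU1 eB nl) !IHn //; congr (_ + _).
by apply: eq_card => F; rewrite !inE fU1 nl.
Qed.

(** Double counting of the pairs of a forest F and a support A containing F:
the supports containing F are the complements of the subsets of the complement
of F. *)
Lemma card_classes_forests (G : multigraph) :
  #|cycle_reversal_classes G| =
    \sum_(F : {set edge G} | forest F) 2 ^ (#|edge G| - #|F|).
Proof.
rewrite card_cycle_reversal_classes.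
transitivity (\sum_(A : {set edge G}) \sum_(F : {set edge G} | forest F && (F \subset A)) 1).
  apply: eq_bigr => A _; rewrite card_scores -sum1_card; apply: eq_bigl => F.
  by rewrite inE andbC.
rewrite (exchange_big_dep (@forest G)) => [|A F _ /andP[]] //=.
apply: eq_bigr => F fF.
have -> : #|edge G| - #|F| = #|~: F| by rewrite [in RHS]cardsCs setCK.
rewrite -card_powerset.
rewrite -(card_imset _ (@setC_inj (edge G))) -sum1_card; apply: eq_bigl => A.
rewrite fF /= -[A]setCK (mem_imset _ _ (@setC_inj _)) setCK inE.
by rewrite setCS.
Qed.

Local Open Scope ring_scope.
Import GRing.Theory.

Theorem theorem3p7 (G : multigraph) (hG : connected_graph G) :
  #|cycle_reversal_classes G|%:Z = 2 ^+ genus G * (tutte G).[3, 1] :> int.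
Proof.
case/andP: hG => V_gt0 /forallP conn.
have nc1 : ncomponents [set: edge G] = 1%N.
  case/card_gt0P: V_gt0 => x _; rewrite -(n_comp_connect (adj_connect_sym [set: edge G]) x).
  by apply: eq_n_comp_r => y; apply/esym; exact: (forallP (conn x)).
have := card_leq_ncomponents [set: edge G]; rewrite nc1 cardsT => leVE.
have tutteE : (tutte G).[3, 1] =
    \sum_(F : {set edge G}) 2 ^+ (rank [set: edge G] - rank F) * 0 ^+ (#|F| - rank F).
  rewrite /tutte !horner_sum; apply: eq_bigr => F _.
  by rewrite !hornerE /=.
rewrite tutteE card_classes_forests -natz natr_sum mulr_sumr [RHS](bigID (@forest G)) /=.
(* Since y - 1 = 0, a set of positive nullity contributes nothing. *)
rewrite [X in _ + X]big1 ?addr0 => [|F]; last first.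
  by rewrite /forest -subn_eq0 expr0n => /negbTE->; rewrite !mulr0.
apply: eq_bigr => F fF.
have rF : rank F = #|F| by apply/eqP; rewrite eqn_leq rank_leq_card.
rewrite rF subnn expr0 mulr1 -exprD.
have := ncomponents_gt0 F V_gt0; have := ncomponents_leq F.
move: rF; rewrite /rank nc1 /genus => rF lenc nc_gt0.
(* genus + corank = (#|E| + 1 - #|V|) + (#|V| - 1 - #|F|). *)
rewrite (_ : (_ + _)%N = #|edge G| - #|F|)%N; last by lia.
by rewrite natrX.
Qed.
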